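(* Let $\Gamma$ be a finite graph and let $X=\{g_1,\ldots,g_k\}$ be an irredundant collection of nonidentity, pure elements of $A(\Gamma)$. Then for all sufficiently large $N$ there is an isomorphism $A(\mathrm{Comm}(X))\cong\langle g_1^N,\ldots,g_k^N\rangle\le A(\Gamma)$.
   Context: For a finite simplicial graph $\Lambda$, $A(\Lambda)=\langle V(\Lambda)\mid [a,b]=1 \text{ for each } \{a,b\}\in E(\Lambda)\rangle$. $\mathrm{Comm}(X)$ is the commutation graph of $X$: its vertex set is $X$, and two distinct vertices are adjacent iff the corresponding group elements commute. The collection $X$ is irredundant if no two (distinct) elements of $X$ share a common nonzero power (equivalently, no two generate a cyclic subgroup). The support of an element of $A(\Gamma)$ is the set of vertices $v$ such that $v^{\pm1}$ occurs in a shortest word representing it; an element is cyclically reduced if its word length is minimal in its conjugacy class. An element $1\ne g\in A(\Gamma)$ is pure if, after cyclic reduction, it cannot be written as a product of two nontrivial commuting subwords with disjoint supports; equivalently, the subgraph of $\Gamma$ induced by the support of a cyclically reduced conjugate of $g$ is not a join (a graph is a join if its vertices can be partitioned into two nonempty sets with every vertex of one adjacent to every vertex of the other). *)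

(* Defs.v *)
(* MathComp, with mathcomp-classical for sets and excluded middle. *)
From HB Require Import structures.
From mathcomp Require Import all_boot ssralg ssrint finmap.
From mathcomp Require Import boolp classical_sets.

Set Implicit Arguments.
Unset Strict Implicit.
Unset Printing Implicit Defensive.

Local Open Scope quotient_scope.
Local Open Scope group_scope.

Record sgraph := SGraph {
  vertex : finType;
  adj : rel vertex;
  adj_sym : symmetric adj;
  adj_irrefl : irreflexive adj }.

Section Words.
Variable L : sgraph.

(* The letter (v, false) stands for v, and (v, true) for its inverse. *)
Definition letter := (vertex L * bool)%type.
Definition word := seq letter.

Definition inv_letter (l : letter) : letter := (l.1, ~~ l.2).
Definition inv_word (w : word) : word := rev (map inv_letter w).
Definition comm_word (a b : vertex L) : word :=
  [:: (a, true); (b, true); (a, false); (b, false)].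

(* Equality in A(L): the least congruence on words which makes mutually
   inverse letters cancel and kills [a, b] for every edge {a, b}. *)
Inductive weqv : word -> word -> Prop :=
| weqv_refl u : weqv u u
| weqv_sym u v : weqv u v -> weqv v u
| weqv_trans u v w : weqv u v -> weqv v w -> weqv u w
| weqv_cat u u' v v' : weqv u u' -> weqv v v' -> weqv (u ++ v) (u' ++ v')
| weqv_cancel l : weqv [:: l; inv_letter l] [::]
| weqv_edge a b : adj a b -> weqv (comm_word a b) [::].

Definition weqvb : rel word := fun u v => `[< weqv u v >].

Lemma weqvb_equiv : equiv_class_of weqvb.
Proof.
split=> [u|u v|v u w]; first by apply/asboolP; exact: weqv_refl.
- by apply/asboolP/asboolP; exact: weqv_sym.
- by move=> /asboolP uv /asboolP vw; apply/asboolP; exact: weqv_trans uv vw.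
Qed.

Canonical weqvb_rel := EquivRelPack weqvb_equiv.

Lemma inv_wordK : involutive inv_word.
Proof.
move=> w; rewrite /inv_word map_rev revK -map_comp -[RHS]map_id.
by apply: eq_map => -[v s]; rewrite /= /inv_letter /= negbK.
Qed.

Lemma inv_word_cat u v : inv_word (u ++ v) = inv_word v ++ inv_word u.
Proof. by rewrite /inv_word map_cat rev_cat. Qed.

Lemma weqv_wV w : weqv (w ++ inv_word w) [::].
Proof.
elim: w => [|l w IH]; first exact: weqv_refl.
rewrite -cat1s inv_word_cat -catA (catA w) -[inv_word [:: l]]/([:: inv_letter l]).
apply: weqv_trans (weqv_cancel l).
exact: (weqv_cat (weqv_refl [:: l]) (weqv_cat IH (weqv_refl _))).
Qed.

Lemma weqv_Vw w : weqv (inv_word w ++ w) [::].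
Proof. by have := weqv_wV (inv_word w); rewrite inv_wordK. Qed.

Lemma weqv_inv u v : weqv u v -> weqv (inv_word u) (inv_word v).
Proof.
move=> uv; apply: (@weqv_trans _ (inv_word u ++ (v ++ inv_word v))).
  rewrite -{1}[inv_word u]cats0; apply: weqv_cat (weqv_refl _) _.
  exact/weqv_sym/weqv_wV.
rewrite catA -[X in weqv _ X]cat0s; apply: weqv_cat (weqv_refl _).
apply: weqv_trans (weqv_Vw u).
exact: weqv_cat (weqv_refl _) (weqv_sym uv).
Qed.

End Words.

Definition raag (L : sgraph) := {eq_quot @weqvb L}.
HB.instance Definition _ (L : sgraph) :=
  Choice.copy (raag L) {eq_quot @weqvb L}.

Section Raag.
Variable L : sgraph.

Definition ev (w : word L) : raag L := \pi_({eq_quot @weqvb L}) w.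

Lemma ev_eq u v : ev u = ev v <-> weqv u v.
Proof.
rewrite /ev; split=> [/eqmodP/asboolP //|uv].
by apply/eqmodP/asboolP.
Qed.

Lemma ev_repr (g : raag L) : ev (repr g) = g.
Proof. exact: reprK. Qed.

Lemma ev_surj (g : raag L) : exists w, ev w = g.
Proof. by exists (repr g); exact: ev_repr. Qed.

Definition raag_one : raag L := ev [::].
Definition raag_mul (g h : raag L) : raag L := ev (repr g ++ repr h).
Definition raag_inv (g : raag L) : raag L := ev (inv_word (repr g)).

Lemma ev_cat u v : ev (u ++ v) = raag_mul (ev u) (ev v).
Proof. by apply/ev_eq/weqv_cat; apply/ev_eq; rewrite ev_repr. Qed.

Lemma ev_inv u : ev (inv_word u) = raag_inv (ev u).
Proof. by apply/ev_eq/weqv_inv/ev_eq; rewrite ev_repr. Qed.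

Lemma raag_mulA : associative raag_mul.
Proof.
move=> x y z; rewrite -(ev_repr x) -(ev_repr y) -(ev_repr z).
by rewrite -!ev_cat catA.
Qed.

Lemma raag_mul1g : left_id raag_one raag_mul.
Proof. by move=> x; rewrite -(ev_repr x) -ev_cat. Qed.

Lemma raag_mulg1 : right_id raag_one raag_mul.
Proof. by move=> x; rewrite -(ev_repr x) -ev_cat cats0. Qed.

Lemma raag_mulVg : left_inverse raag_one raag_inv raag_mul.
Proof.
by move=> x; rewrite -(ev_repr x) -ev_inv -ev_cat; apply/ev_eq/weqv_Vw.
Qed.

Lemma raag_mulgV : right_inverse raag_one raag_inv raag_mul.
Proof.
by move=> x; rewrite -(ev_repr x) -ev_inv -ev_cat; apply/ev_eq/weqv_wV.
Qed.

End Raag.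

HB.instance Definition _ (L : sgraph) := isGroup.Build (raag L)
  (@raag_mulA L) (@raag_mul1g L) (@raag_mulg1 L) (@raag_mulVg L) (@raag_mulgV L).

Section Pure.
Variable L : sgraph.
Implicit Types g h : raag L.

Definition represented_in g (n : nat) : bool :=
  `[< exists2 w : word L, ev w = g & size w = n >].

Lemma represented_ex g : exists n, represented_in g n.
Proof. by have [w wg] := ev_surj g; exists (size w); apply/asboolP; exists w. Qed.

Definition wlen g : nat := ex_minn (represented_ex g).

Definition shortest_word (w : word L) g : Prop := ev w = g /\ size w = wlen g.

Definition supp g : {set vertex L} :=
  [set v | `[< exists w s, shortest_word w g /\ (v, s) \in w >]].

Definition cyclically_reduced g : Prop := forall x, wlen g <= wlen (g ^ x).

Lemma cyclic_reduction_ex g : exists x, cyclically_reduced (g ^ x).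
Proof.
have exn : exists n, `[< exists x, wlen (g ^ x) = n >].
  by exists (wlen (g ^ 1)); apply/asboolP; exists 1.
case: (ex_minnP exn) => n /asboolP[x <-] min_x; exists x => y.
by apply: min_x; apply/asboolP; exists (x * y); rewrite conjgM.
Qed.

(* A shortest word for h is cut into two consecutive subwords; subwords of a
   shortest word are shortest, so supp (ev u) is the set of letters of u. *)
Definition splits h : Prop :=
  exists u v : word L,
    [/\ shortest_word (u ++ v) h, ev u != 1, ev v != 1,
        commute (ev u) (ev v) & [disjoint supp (ev u) & supp (ev v)]].

(* Cyclically reduced conjugates of g exist (cyclic_reduction_ex) and differ
   by cyclic permutations, so quantifying over all of them is harmless. *)
Definition pure g : Prop :=
  g != 1 /\ forall x, cyclically_reduced (g ^ x) -> ~ splits (g ^ x).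

End Pure.

Section Groups.
Variable G : groupType.

Definition expgz (g : G) (m : int) : G :=
  match m with Posz n => g ^+ n | Negz n => g ^- n.+1 end.

(* The two exponents need not be equal: in a torsion-free group this says that
   no two distinct nontrivial elements of X generate a cyclic subgroup. *)
Definition irredundant (X : {fset G}) : Prop :=
  forall g h, g \in X -> h \in X -> g != h ->
    ~ exists m n : int, [/\ m != 0%R, n != 0%R & expgz g m = expgz h n].

Definition comm_adj (X : {fset G}) : rel X :=
  fun x y => (x != y) && (val x * val y == val y * val x).

Lemma comm_adj_sym (X : {fset G}) : symmetric (@comm_adj X).
Proof. by move=> x y; rewrite /comm_adj eq_sym [_ * _ == _]eq_sym. Qed.

Lemma comm_adj_irrefl (X : {fset G}) : irreflexive (@comm_adj X).
Proof. by move=> x; rewrite /comm_adj eqxx. Qed.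

Definition comm_graph (X : {fset G}) : sgraph :=
  SGraph (@comm_adj_sym X) (@comm_adj_irrefl X).

Local Open Scope classical_set_scope.

Definition is_subgroup (H : set G) : Prop :=
  H 1 /\ forall x y, H x -> H y -> H (x / y).

Definition generated (S : set G) : set G := smallest is_subgroup S.

Definition powers (X : {fset G}) (N : nat) : set G :=
  [set g ^+ N | g in [set` X]].

End Groups.

(* K is meant to be a subgroup of H. *)
Definition isomorphic_to (G H : groupType) (K : set H) : Prop :=
  exists f : {multiplicative G -> H}, injective f /\ range f = K.

(* Main.v *)
Require Import Defs.
From HB Require Import structures.
From mathcomp Require Import all_boot ssralg ssrint finmap zify.
From mathcomp Require Import boolp.
From mathcomp Require classical_sets.

Set Implicit Arguments.
Unset Strict Implicit.
Unset Printing Implicit Defensive.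

Local Open Scope group_scope.

(** The powers [g ^+ N], for [g] in [X], play ping-pong on the group itself.

Conjugate each [g] in [X] to the value of a cyclically reduced word [c], say
[g ^ p = ev c]. The player of [g] is the set of all [h] such that [p^-1 * h]
has a reduced word beginning with [c^M]; the player of [g^-1] is defined in the
same way from the inverse of [c]. Such sets of elements with a prescribed
beginning are called cones below. For the natural map from the right-angled
Artin group of the commutation graph to be injective it suffices
([ping_pong]) that, once [M] and then [N] are large,
- [g ^+ N] sends the complement of the player of [g^-1] into the player of [g]
  ([dichotomy]): purity forces a cancellation in [c^N] that does not stop early
  to swallow a whole power of [c] at the end;
- the players of noncommuting elements are disjoint ([far_cones]), and so are
  those of [g] and [g^-1] ([opposite_cones]);
- each player is stable under the other elements of [X] that commute with its
  owner ([commuting_cone]);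
- no player contains 1 ([shallow_cone]).

Disjointness for noncommuting elements and stability rest on [two_powers]: if
one element of the group has two reduced words, one beginning with [c^n] and
the other with [q d^n], and [n] is large compared with the lengths of [c], [d]
and [q], then either positive powers of [c] and of [q d q^-1] coincide, which
irredundance excludes, or [q d q^-1] is a product of letters commuting with
every letter of [c].

Reduced words of one element differ by exchanges of commuting letters
([reduced_teq]), and two words differ in this way exactly when their
projections to every pair of noncommuting letters coincide. All arguments
about powers thus become statements on periodic lists over two letters. *)

(** * Powers of a list *)

Section ListPowers.
Variable T : eqType.
Implicit Types (s t u v : seq T) (n : nat).

Definition spow n s : seq T := flatten (nseq n s).

Lemma spowS n s : spow n.+1 s = s ++ spow n s. Proof. by []. Qed.

Lemma spow_add m n s : spow (m + n) s = spow m s ++ spow n s.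
Proof. by rewrite /spow nseqD flatten_cat. Qed.

Lemma spowSr n s : spow n.+1 s = spow n s ++ s.
Proof. by rewrite -addn1 spow_add /spow /= cats0. Qed.

Lemma spow_mul m n s : spow m (spow n s) = spow (m * n)%N s.
Proof. by elim: m => [|m IH] //; rewrite spowS IH mulSn spow_add. Qed.

Lemma count_spow a n s : count a (spow n s) = (n * count a s)%N.
Proof. by elim: n => [|n IH] //; rewrite spowS count_cat IH mulSn. Qed.

Lemma size_spow n s : size (spow n s) = (n * size s)%N.
Proof. by rewrite -!count_predT count_spow. Qed.

Lemma filter_spow a n s : filter a (spow n s) = spow n (filter a s).
Proof. by elim: n => [|n IH] //; rewrite spowS filter_cat IH. Qed.

Lemma mem_spow n s x : x \in spow n s -> x \in s.
Proof. by elim: n => [|n IH] //; rewrite spowS mem_cat => /orP[|/IH]. Qed.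

Lemma prefix_total u v l : prefix u l -> prefix v l -> size u <= size v -> prefix u v.
Proof.
move=> /prefixP[a ->] /prefixP[b]; rewrite prefixE => e uv; apply/eqP.
by have := congr1 (take (size u)) e; rewrite take_size_cat // takel_cat.
Qed.

Lemma prefix_eq u v l : prefix u l -> prefix v l -> size u = size v -> u = v.
Proof. by rewrite !prefixE => /eqP eu /eqP ev e; rewrite -eu -ev e. Qed.

Lemma prefix_count a u v : prefix u v -> count a u <= count a v.
Proof. by case/prefixP=> w ->; rewrite count_cat leq_addr. Qed.

Lemma prefix_spow m n s : m <= n -> prefix (spow m s) (spow n s).
Proof. by move=> mn; rewrite -(subnKC mn) spow_add prefix_prefix. Qed.

End ListPowers.

(** * Words up to commutation *)

Section Traces.
Variable L : sgraph.
Implicit Types (u v w t : word L) (l a b : letter L) (x y z : vertex L).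
Local Notation inv := (@inv_letter L).

Lemma inv_letterK : involutive inv.
Proof. by case=> v s; rewrite /inv_letter /= negbK. Qed.

Lemma inv_letter_neq l : (inv l == l) = false.
Proof. by case: l => v []; rewrite /inv_letter /= xpair_eqE eqxx. Qed.

Lemma adj_neq x y : adj x y -> (x == y) = false.
Proof. by move=> xy; apply/eqP => e; move: xy; rewrite e adj_irrefl. Qed.

(** Every vertex is dependent on itself: a letter is never moved past its own
inverse. *)
Definition dep x y := ~~ adj x y.

Lemma dep_sym x y : dep x y = dep y x.
Proof. by rewrite /dep adj_sym. Qed.

Lemma dep_refl x : dep x x.
Proof. by rewrite /dep adj_irrefl. Qed.

Definition proj x y w : word L := [seq l <- w | (l.1 == x) || (l.1 == y)].

(** Equality in the partially commutative monoid, through the projection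
criterion: exchanging commuting letters is visible in no projection to a
dependent pair, and conversely these projections determine the word up to
such exchanges. *)
Definition teq u v := forall x y, dep x y -> proj x y u = proj x y v.

Lemma proj_cat x y u v : proj x y (u ++ v) = proj x y u ++ proj x y v.
Proof. exact: filter_cat. Qed.

Lemma proj_spow x y n u : proj x y (spow n u) = spow n (proj x y u).
Proof. exact: filter_spow. Qed.

Lemma teq_refl u : teq u u. Proof. by []. Qed.

Lemma teq_sym u v : teq u v -> teq v u.
Proof. by move=> uv x y d; rewrite uv. Qed.

Lemma teq_trans v u w : teq u v -> teq v w -> teq u w.
Proof. by move=> uv vw x y d; rewrite uv ?vw. Qed.

Lemma teq_cat u u' v v' : teq u u' -> teq v v' -> teq (u ++ v) (u' ++ v').
Proof. by move=> eu ev x y d; rewrite !proj_cat eu ?ev. Qed.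

Lemma teq_cat2l u v w : teq (u ++ v) (u ++ w) <-> teq v w.
Proof.
split=> [e x y d|e]; last exact: teq_cat.
by have := e x y d; rewrite !proj_cat => /eqP; rewrite eqseq_cat // eqxx => /eqP.
Qed.

Lemma teq_cons2 l v w : teq (l :: v) (l :: w) <-> teq v w.
Proof. exact: (teq_cat2l [:: l]). Qed.

Lemma teq_commute u v :
  (forall a b, a \in u -> b \in v -> adj a.1 b.1) -> teq (u ++ v) (v ++ u).
Proof.
move=> uv x y d; rewrite !proj_cat.
have [->|] := eqVneq (proj x y u) [::]; first by rewrite cats0.
case E: (proj x y u) => [//|a s] _.
have : a \in proj x y u by rewrite E mem_head.
rewrite mem_filter => /andP[ax au].
have -> : proj x y v = [::]; last by rewrite cats0.
apply/eqP; rewrite -size_eq0 size_filter eqn0Ngt -has_count -all_predC.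
apply/allP=> b bv /=; have ab := uv _ _ au bv.
apply/negP=> bx; move: d ab; rewrite /dep.
by case/orP: ax => /eqP ->; case/orP: bx => /eqP ->;
  rewrite ?adj_irrefl // => /negPf; rewrite 1?adj_sym => ->.
Qed.

Lemma teq_swap a b w : adj a.1 b.1 -> teq (a :: b :: w) (b :: a :: w).
Proof.
move=> ab; apply: (@teq_cat [:: a; b] [:: b; a]) => //.
by apply: (@teq_commute [:: a] [:: b]) => ? ?; rewrite !inE => /eqP-> /eqP->.
Qed.

Lemma teq_mem u v : teq u v -> u =i v.
Proof.
move=> uv l; have := congr1 (fun s : word L => l \in s) (uv _ _ (dep_refl l.1)).
by rewrite /= !mem_filter eqxx.
Qed.

Lemma teq_perm u v : teq u v -> perm_eq u v.
Proof.
move=> uv; apply/allP=> l _ /=; apply/eqP.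
have pl w : count_mem l w = count_mem l (proj l.1 l.1 w).
  rewrite count_filter; apply: eq_count => b /=.
  by case: eqP => // ->; rewrite eqxx.
by rewrite pl (uv _ _ (dep_refl _)) -pl.
Qed.

Lemma teq_size u v : teq u v -> size u = size v.
Proof. by move/teq_perm/perm_size. Qed.

(** [l] can be moved to the front of [w]. *)
Fixpoint starts w l :=
  if w is a :: w' then (a == l) || (adj a.1 l.1 && starts w' l) else false.

(** The form of [starts] that shows its invariance under [teq]. *)
Lemma startsP w l :
  reflect (forall y, dep l.1 y -> ohead (proj l.1 y w) = Some l) (starts w l).
Proof.
apply: (iffP idP) => [|].
  elim: w => [//|a w IH] /= /orP[/eqP -> y _|/andP[al /IH hw] y d].
    by rewrite eqxx.
  rewrite adj_neq //=; case: eqP => [e|_]; last exact: hw.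
  by move: d; rewrite -e dep_sym /dep al.
elim: w => [|a w IH] h; first by have := h _ (dep_refl _).
rewrite /=; have [//|al] := eqVneq a l; rewrite /=.
have aa : adj a.1 l.1.
  apply/negPn/negP => d; rewrite -/(dep _ _) dep_sym in d.
  by have /eqP := h _ d; rewrite /= eqxx orbT (inj_eq Some_inj) (negPf al).
rewrite aa; apply: IH => y d; rewrite -(h _ d) /= adj_neq //=.
by case: eqP => // ay; move: d; rewrite -ay dep_sym /dep aa.
Qed.

Lemma teq_starts u v l : teq u v -> starts u l = starts v l.
Proof.
by move=> uv; apply/startsP/startsP => h y d; have := h y d; rewrite uv.
Qed.

Lemma starts_mem w l : starts w l -> l \in w.
Proof.
elim: w => [//|a w IH] /= /orP[/eqP->|/andP[_ /IH h]]; rewrite inE ?eqxx //.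
by rewrite h orbT.
Qed.

Lemma starts_cat u v l :
  starts (u ++ v) l = starts u l || all (fun a => adj a.1 l.1) u && starts v l.
Proof.
elim: u => [//|a u IH] /=; rewrite IH.
by case: (a == l); case: (adj _ _).
Qed.

Lemma teq_rem w l : starts w l -> teq w (l :: rem l w).
Proof.
elim: w => [//|a w IH] /=; have [-> //|al] := eqVneq a l.
move=> /= /andP[aa /IH h]; apply: teq_trans (teq_swap _ aa).
exact/teq_cons2.
Qed.

Lemma ev_swap a b : adj a.1 b.1 -> commute (ev [:: a]) (ev [:: b]).
Proof.
have base x y : adj x y -> commute (ev [:: (x, false)]) (ev [:: (y, false)]).
  move=> xy; apply/commgP/eqP.
  have /ev_eq E := weqv_edge xy.
  transitivity (ev (comm_word x y)); last exact: E.
  have -> : comm_word x y = inv_word [:: (x, false)] ++ inv_word [:: (y, false)]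
    ++ [:: (x, false)] ++ [:: (y, false)] by [].
  by rewrite commgEl conjgE !ev_cat !ev_inv.
have tr x : ev [:: (x, true)] = (ev [:: (x, false)])^-1 :> raag L.
  by rewrite -[RHS]ev_inv.
case: a b => x [] [y []] /= /base xy; rewrite ?tr //.
- exact/commuteV/commute_sym/commuteV/commute_sym.
- exact/commute_sym/commuteV/commute_sym.
- exact/commuteV.
Qed.

Lemma ev_cons l w : ev (l :: w) = ev [:: l] * ev w.
Proof. by rewrite -cat1s ev_cat. Qed.

Lemma evM u v : ev (u ++ v) = ev u * ev v. Proof. exact: ev_cat. Qed.
Lemma evV u : ev (inv_word u) = (ev u)^-1. Proof. exact: ev_inv. Qed.
Lemma evX n u : ev (spow n u) = ev u ^+ n.
Proof. by elim: n => [//|n IH]; rewrite spowS evM IH expgS. Qed.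

Lemma ev_invl l : ev [:: inv l] = (ev [:: l])^-1.
Proof. by rewrite -evV. Qed.

Lemma ev_rem w l : starts w l -> ev w = ev (l :: rem l w).
Proof.
elim: w => [//|a w IH] /=; have [-> //|al] := eqVneq a l.
move=> /= /andP[aa /IH h]; rewrite ev_cons h.
rewrite (ev_cons l (a :: _)) (ev_cons l (rem l w)) (ev_cons a (rem l w)).
by rewrite !mulgA (ev_swap aa).
Qed.

Lemma teq_nil w : teq [::] w -> w = [::].
Proof. by move/teq_size => /esym/size0nil. Qed.

Lemma teq_rem_cons l u v : teq (l :: u) v -> starts v l /\ teq u (rem l v).
Proof.
move=> e; have sv : starts v l by rewrite -(teq_starts _ e) /= eqxx.
by split=> //; apply/(teq_cons2 l)/(teq_trans e)/teq_rem.
Qed.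

(** The first letter of [u] can be moved to the front of [v]; cancel it in
both and repeat. *)
Lemma teq_ev u v : teq u v -> ev u = ev v.
Proof.
elim: u v => [|l u IH] v; first by move/teq_nil->.
by case/teq_rem_cons => sv /IH e; rewrite (ev_rem sv) ev_cons e -ev_cons.
Qed.

(** * Reduced words *)

(** No letter meets its inverse after exchanges of commuting letters. *)
Fixpoint reduced w :=
  if w is l :: w' then ~~ starts w' (inv l) && reduced w' else true.

Lemma adj_neq_inv a b : adj a.1 b.1 -> (a == inv b) = false.
Proof. by move=> ab; apply/eqP => e; move: ab; rewrite e adj_irrefl. Qed.

Lemma reduced_rem w l : starts w l -> reduced w = reduced (l :: rem l w).
Proof.
elim: w => [//|a w IH] /=; have [-> //|al] := eqVneq a l.
move=> /= /andP[aa sw]; rewrite (IH sw) (teq_starts _ (teq_rem sw)) /=.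
have la : adj l.1 a.1 by rewrite adj_sym.
by rewrite !adj_neq_inv // aa la /= andbCA.
Qed.

Lemma teq_reduced u v : teq u v -> reduced u = reduced v.
Proof.
elim: u v => [|l u IH] v; first by move/teq_nil->.
case/teq_rem_cons => sv e; rewrite (reduced_rem sv) /=.
by rewrite (IH _ e) (teq_starts _ e).
Qed.

Lemma reduced_catr u v : reduced (u ++ v) -> reduced v.
Proof. by elim: u => [//|l u IH] /= /andP[_ /IH]. Qed.

Lemma reduced_catl u v : reduced (u ++ v) -> reduced u.
Proof.
elim: u => [//|l u IH] /=; rewrite starts_cat negb_or => /andP[/andP[-> _] /IH].
by [].
Qed.

(** Left multiplication by a letter on reduced words. Letting words act in this
way respects the defining relations up to [teq] ([weqv_acts]), which solves
the word problem. *)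
Definition act l w : word L := if starts w (inv l) then rem (inv l) w else l :: w.
Definition acts u w : word L := foldr act w u.
Definition nf u : word L := acts u [::].

Lemma reduced_act l w : reduced w -> reduced (act l w).
Proof.
rewrite /act; case: ifPn => [sw|sw rw]; last by rewrite /= sw.
by rewrite (reduced_rem sw) => /andP[].
Qed.

Lemma reduced_acts u w : reduced w -> reduced (acts u w).
Proof. by move=> rw; elim: u => //= l u; apply: reduced_act. Qed.

Lemma reduced_nf u : reduced (nf u).
Proof. exact: reduced_acts. Qed.

Lemma teq_act l u v : teq u v -> teq (act l u) (act l v).
Proof.
move=> uv; rewrite /act (teq_starts _ uv); case: ifP => sv; last exact/teq_cons2.
have su : starts u (inv l) by rewrite (teq_starts _ uv).
apply/(teq_cons2 (inv l))/(teq_trans _ (teq_rem sv)).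
exact/teq_sym/(teq_trans (teq_sym uv))/teq_rem.
Qed.

Lemma act_inv l w : reduced w -> teq (act l (act (inv l) w)) w.
Proof.
move=> rw; rewrite {2}/act inv_letterK; case: ifPn => sw.
  move: rw; rewrite (reduced_rem sw) /= => /andP[/negPf sr _].
  by rewrite /act sr; apply/teq_sym/teq_rem.
by rewrite /act /= eqxx.
Qed.

Lemma starts_act a b w : adj a.1 b.1 -> starts (act b w) a = starts w a.
Proof.
move=> ab; have ba : adj b.1 a.1 by rewrite adj_sym.
have bai : (b == a) = false.
  by apply/eqP => e; move: ab; rewrite e adj_irrefl.
rewrite /act; case: ifP => sw /=; last by rewrite bai ba.
rewrite (teq_starts a (teq_rem sw)) /= ba.
by case: eqP => // e; move: ab; rewrite -e adj_irrefl.
Qed.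

Lemma act_comm a b w : adj a.1 b.1 -> teq (act a (act b w)) (act b (act a w)).
Proof.
move=> ab; have ba : adj b.1 a.1 by rewrite adj_sym.
have sa : starts (act b w) (inv a) = starts w (inv a) by rewrite starts_act.
have sb : starts (act a w) (inv b) = starts w (inv b) by rewrite starts_act.
have abV : (inv a == b) = false by rewrite eq_sym adj_neq_inv.
have baV : (inv b == a) = false by rewrite eq_sym adj_neq_inv.
rewrite {1}[act a (act b w)]/act {1}[act b (act a w)]/act sa sb.
case: ifP sa sb => wa; case: ifP => wb; rewrite /act wa wb => sa sb.
- apply/(teq_cons2 (inv b))/(teq_cons2 (inv a)).
  apply: (@teq_trans w); last first.
    exact: (teq_trans (teq_rem wa) ((teq_cons2 _ _ _).2 (teq_rem sb))).
  apply: teq_trans (teq_swap _ _) _ => //.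
  apply/teq_sym.
  exact: (teq_trans (teq_rem wb) ((teq_cons2 _ _ _).2 (teq_rem sa))).
- by rewrite /= eq_sym abV.
- by rewrite /= eq_sym baV.
- exact: teq_swap.
Qed.

Lemma acts_cat u v w : acts (u ++ v) w = acts u (acts v w).
Proof. exact: foldr_cat. Qed.

Lemma weqv_acts u v : weqv u v ->
  forall t t', reduced t -> teq t t' -> teq (acts u t) (acts v t').
Proof.
elim=> {u v} [u|u v _ IH|u v w _ IH1 _ IH2|u u' v v' _ IH1 _ IH2|l|a b ab]
  t t' rt tt'.
- by elim: u => //= l u; apply: teq_act.
- by apply/teq_sym/IH; rewrite -?(teq_reduced tt') //; apply: teq_sym.
- by apply: teq_trans (IH1 _ _ rt tt') (IH2 _ _ _ _); rewrite -?(teq_reduced tt').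
- by rewrite !acts_cat; apply: IH1 (IH2 _ _ _ _); rewrite ?reduced_acts.
- exact: (teq_trans (act_inv l rt)).
- apply: teq_trans tt'; rewrite /comm_word /=.
  apply: (@teq_trans (act (a, true) (act (b, true) (act (b, false) (act (a, false) t))))).
    exact/teq_act/teq_act/act_comm.
  apply: (@teq_trans (act (a, true) (act (a, false) t))).
    by apply/teq_act/(act_inv (b, true)); rewrite reduced_act.
  exact: (act_inv (a, true)).
Qed.

Lemma nf_id u : reduced u -> nf u = u.
Proof.
elim: u => [//|l u IH] /= /andP[su /IH e].
by rewrite /nf /= -/(nf u) e /act (negPf su).
Qed.

Lemma ev_act l u : ev (act l u) = ev (l :: u).
Proof.
rewrite /act; case: ifP => // su; rewrite (ev_cons l u) (ev_rem su) (ev_cons (inv l) (rem _ _)).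
by rewrite ev_invl mulVKg.
Qed.

Lemma ev_acts u w : ev (acts u w) = ev (u ++ w).
Proof. by elim: u => //= l u IH; rewrite ev_act ev_cons IH -ev_cons. Qed.

Lemma ev_nf u : ev (nf u) = ev u.
Proof. by rewrite ev_acts cats0. Qed.

Lemma size_act l u : size (act l u) <= (size u).+1 ?= iff ~~ starts u (inv l).
Proof.
rewrite /act; case: ifP => su /=; first last.
  by split; rewrite ?eqxx /=.
have sr : size (rem (inv l) u) = (size u).-1 by exact/size_rem/starts_mem.
by split; rewrite sr; lia.
Qed.

(** The action of [u] on the empty word pushes its letters one by one, so it
rebuilds [u]; but it depends only on [ev u]. *)
Lemma reduced_teq u v : reduced u -> reduced v -> ev u = ev v -> teq u v.
Proof.
move=> ru rv /ev_eq /weqv_acts /(_ [::] [::] isT (teq_refl _)).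
by rewrite -/(nf u) -/(nf v) !nf_id.
Qed.

Lemma size_nf u : size (nf u) <= size u ?= iff reduced u.
Proof.
elim: u => [|l u IH] //=; rewrite {1}/nf /= -/(nf u).
have [h1 h2] := size_act l (nf u); have [h3 h4] := IH.
split; first by apply: leq_trans h1 _.
case: (boolP (reduced u)) => ru; last first.
  by rewrite andbF; move: h4; rewrite (negPf ru) => /negbT ne; apply/negbTE; lia.
by rewrite andbT nf_id // in h2 *.
Qed.

Lemma wlen_min w : wlen (ev w) <= size w.
Proof. by rewrite /wlen; case: ex_minnP => n _; apply; apply/asboolP; exists w. Qed.

Lemma wlenE u : reduced u -> wlen (ev u) = size u.
Proof.
move=> ru; apply/eqP; rewrite eqn_leq wlen_min /=.
rewrite {1}/wlen; case: ex_minnP => n /asboolP[w ew <-] _.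
apply: leq_trans (size_nf w).1.
by rewrite (teq_size (@reduced_teq u (nf w) _ _ _)) ?reduced_nf // ev_nf.
Qed.

Lemma reducedE u : reduced u = (size u == wlen (ev u)).
Proof.
apply/idP/eqP => [/wlenE //|e]; rewrite -(size_nf u).2 eqn_leq (size_nf u).1 /=.
by rewrite e -(ev_nf u) wlen_min.
Qed.

Lemma ev_reduced (g : raag L) : exists2 u, reduced u & ev u = g.
Proof. by have [w <-] := ev_surj g; exists (nf w); rewrite ?reduced_nf ?ev_nf. Qed.

Lemma wlenM (g h : raag L) : wlen (g * h) <= wlen g + wlen h.
Proof.
have [u ru <-] := ev_reduced g; have [v rv <-] := ev_reduced h.
by rewrite -evM (wlenE ru) (wlenE rv) -size_cat wlen_min.
Qed.

Lemma wlenV (g : raag L) : wlen g^-1 = wlen g.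
Proof.
have le (h : raag L) : wlen h^-1 <= wlen h.
  have [u ru <-] := ev_reduced h; rewrite -evV (wlenE ru).
  by apply: leq_trans (wlen_min _) _; rewrite /inv_word size_rev size_map.
by apply/eqP; rewrite eqn_leq le -{1}(invgK g) le.
Qed.

Lemma reduced_inv u : reduced u -> reduced (inv_word u).
Proof.
rewrite !reducedE => /eqP e.
by rewrite evV wlenV /inv_word size_rev size_map e.
Qed.

End Traces.

(** * Cones and cancellation against a power *)

Section Cones.
Variable L : sgraph.
Implicit Types (u v w t a b c d : word L) (l : letter L) (x y z : vertex L).
Implicit Types (g h p q : raag L).
Local Notation inv := (@inv_letter L).
Local Notation V := (vertex L).

(** Being a prefix up to commutation is also decided by the projections. *)
Lemma teq_prefix u w :
  (forall x y, dep x y -> prefix (proj x y u) (proj x y w)) ->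
  exists r, teq w (u ++ r).
Proof.
elim: u w => [|l u IH] w h; first by exists w.
have sw : starts w l.
  apply/startsP => y d; have := h _ _ d; rewrite {1}/proj /= eqxx /=.
  by case: (proj _ _ w) => //= b s /andP[/eqP->].
have [r er] : exists r, teq (rem l w) (u ++ r).
  apply: IH => x y d; have := h _ _ d; rewrite (teq_rem sw d) {1 3}/proj /=.
  by case: ifP => //= _; rewrite eqxx.
by exists r; apply: teq_trans (teq_rem sw) _; apply/teq_cons2.
Qed.

Lemma inv_word_cons l u : inv_word (l :: u) = inv_word u ++ [:: inv l].
Proof. by rewrite -cat1s inv_word_cat. Qed.

Lemma proj_inv x y u : proj x y (inv_word u) = inv_word (proj x y u).
Proof. by rewrite /proj /inv_word filter_rev filter_map. Qed.

Lemma teq_inv u v : teq u v -> teq (inv_word u) (inv_word v).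
Proof. by move=> e x y d; rewrite !proj_inv e. Qed.

Lemma inv_word_spow n u : inv_word (spow n u) = spow n (inv_word u).
Proof. by elim: n => [//|n IH]; rewrite spowSr inv_word_cat IH. Qed.

Lemma size_inv u : size (inv_word u) = size u.
Proof. by rewrite /inv_word size_rev size_map. Qed.

Lemma mem_inv l u : (l \in inv_word u) = (inv l \in u).
Proof. by rewrite mem_rev -{1}(inv_letterK l) mem_map //; apply/inv_inj/inv_letterK. Qed.

Lemma reduced_cat u v : reduced u -> reduced v ->
  (forall l, starts (inv_word u) l -> starts v l -> False) -> reduced (u ++ v).
Proof.
move=> + rv; elim: u => [//|a u IH] /= /andP[sa ru] h; rewrite IH // ?andbT.
  rewrite starts_cat (negPf sa) /=; apply/negP => /andP[au].
  apply: h; rewrite inv_word_cons starts_cat; apply/orP; right.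
  rewrite /= eqxx andbT; apply/allP => b; rewrite mem_inv => /(allP au).
  by case: b.
by move=> l su; apply: h; rewrite inv_word_cons starts_cat su.
Qed.

Lemma starts_inv u l : starts (inv_word u) l -> exists u', teq u (u' ++ [:: inv l]).
Proof.
move=> su; exists (inv_word (rem l (inv_word u))).
by rewrite -inv_word_cons -{1}(inv_wordK u); apply/teq_inv/teq_rem.
Qed.

Lemma reduced_catE u v l :
  reduced (u ++ v) -> starts (inv_word u) l -> starts v l -> False.
Proof.
move=> r /starts_inv[u' eu] /teq_rem ev; move: r.
rewrite (teq_reduced (teq_cat eu ev)) -catA => /reduced_catr /=.
by rewrite inv_letterK eqxx.
Qed.

(** Multiply [t] by the letters of [u], from the last one to the first. Since
[u] is reduced, a letter that cancels does so with a letter of [t], across the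
letters of [u] that have survived so far; it commutes with these, so it can be
moved behind them, into [b]. *)
Lemma cancellation u t : reduced u -> reduced t ->
  exists a b t', [/\ teq u (a ++ b), teq t (inv_word b ++ t') & reduced (a ++ t')].
Proof.
move=> + rt; elim: u => [|l u IH] /=; first by exists [::], [::], t.
move=> /andP[sl /IH[a [b [t' [eu et rat]]]]].
case: (boolP (starts (a ++ t') (inv l))) => sat; last first.
  exists (l :: a), b, t'; split=> //; last by rewrite /= sat.
  exact: (teq_cons2 l u (a ++ b)).2.
move: sat; rewrite starts_cat => /orP[sa|/andP[aa st']].
  by move: sl; rewrite (teq_starts _ eu) starts_cat sa.
have la : teq (l :: a) (a ++ [:: l]).
  apply: (@teq_commute _ [:: l]) => m n; rewrite inE => /eqP -> /(allP aa).
  by rewrite adj_sym.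
have la' : teq (inv l :: a) (a ++ [:: inv l]).
  apply: (@teq_commute _ [:: inv l]) => m n; rewrite inE => /eqP -> /(allP aa).
  by rewrite adj_sym.
exists a, (l :: b), (rem (inv l) t'); split.
- apply: (@teq_trans _ ((l :: a) ++ b)); first exact: (teq_cons2 l u (a ++ b)).2.
  by rewrite -(cat1s l b) catA; apply: teq_cat.
- apply: teq_trans et _; rewrite inv_word_cons -catA; apply/teq_cat2l.
  exact: teq_rem.
- suff : reduced ((inv l :: a) ++ rem (inv l) t') by move=> /andP[].
  rewrite (teq_reduced (teq_cat la' (@teq_refl _ (rem (inv l) t')))) -catA.
  by rewrite -(teq_reduced (teq_cat (@teq_refl _ a) (teq_rem st'))).
Qed.

Definition vcount x u := count (fun l => l.1 == x) u.

Lemma vcount_inv x u : vcount x (inv_word u) = vcount x u.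
Proof. by rewrite /vcount /inv_word count_rev count_map; apply: eq_count. Qed.

Lemma vcount_spow x n u : vcount x (spow n u) = (n * vcount x u)%N.
Proof. exact: count_spow. Qed.

Lemma vcount_projl x y u : vcount x (proj x y u) = vcount x u.
Proof. by rewrite /vcount count_filter; apply: eq_count => l /=; case: eqP. Qed.

Lemma vcount_projr x y u : vcount y (proj x y u) = vcount y u.
Proof. by rewrite /vcount count_filter; apply: eq_count => l /=; rewrite orbC; case: eqP. Qed.

Lemma size_proj x y u : size (proj x y u) = (vcount x u + (x != y) * vcount y u)%N.
Proof.
rewrite size_filter; case: eqP => [<-|/eqP xy].
  by rewrite addn0; apply: eq_count => l /=; rewrite orbb.
rewrite mul1n -count_predUI [X in (_ + X)%N](_ : _ = 0) ?addn0 //.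
apply/eqP; rewrite -leqn0 leqNgt -has_count; apply/hasP => -[l _ /=].
by case/andP=> /eqP -> /eqP e; rewrite e eqxx in xy.
Qed.

Lemma vcount_mem l u : l \in u -> 0 < vcount l.1 u.
Proof. by move=> lu; rewrite -has_count; apply/hasP; exists l. Qed.

Lemma mem_vcount x u : 0 < vcount x u -> exists2 l, l \in u & l.1 = x.
Proof. by rewrite -has_count => /hasP[l lu /eqP lx]; exists l. Qed.

(** Connectedness of the dependence graph on the letters of [c], as an
induction principle over the letters. For a cyclically reduced word it is
the content of purity ([nonsplit_dep_connected]). *)
Definition dep_connected c := forall T : {set V},
  (exists2 x, x \in T & 0 < vcount x c) ->
  (forall x y, x \in T -> 0 < vcount x c -> 0 < vcount y c -> dep x y -> y \in T) ->
  forall y, 0 < vcount y c -> y \in T.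

(** The words obtained from pure elements by cyclic reduction ([pure_form]);
cyclic reducedness takes the form that all powers are reduced. *)
Definition pure_word c :=
  [/\ 0 < size c, forall n, reduced (spow n c) & dep_connected c].

Lemma pure_word_inv c : pure_word c -> pure_word (inv_word c).
Proof.
case=> c0 rc cc; split; first by rewrite size_inv.
  by move=> n; rewrite -inv_word_spow; apply: reduced_inv.
move=> T [x xT]; rewrite vcount_inv => xc h y; rewrite vcount_inv.
apply: cc; first by exists x.
by move=> x' y' x'T x'c y'c; apply: h; rewrite ?vcount_inv.
Qed.

(** The prefix [r] contains more than [m] periods' worth of [Q], so it contains
the first [m] periods. *)
Lemma prefix_spow_count (T : eqType) (s r : seq T) n m (P Q : pred T) :
  prefix r (spow n s) -> (m * count Q s < count Q r)%N ->
  (m * count P s <= count P r)%N.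
Proof.
move=> rs mr; have rs' := prefix_trans rs (prefix_spow s (leq_maxr m n)).
have ms := prefix_spow s (leq_maxl m n).
rewrite -count_spow; apply: prefix_count.
have /orP[|sz] := leq_total (size (spow m s)) (size r); first exact: prefix_total ms rs'.
have /(prefix_count Q) := prefix_total rs' ms sz; rewrite count_spow.
by rewrite leqNgt mr.
Qed.

(** Along a noncommuting pair of letters a prefix of [c^n] sees the letters in
a fixed periodic order, so its progress at the two letters differs by at most
one period. Connectedness spreads this to the whole support, at the cost of
one period per vertex. *)
Lemma progress c n a b j x : dep_connected c -> teq (spow n c) (a ++ b) ->
  0 < vcount x c -> vcount x a <= (j * vcount x c)%N ->
  forall y, 0 < vcount y c -> vcount y a <= ((j + #|V|) * vcount y c)%N.
Proof.
move=> cc e xc xa.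
have step y z i : dep y z -> 0 < vcount y c ->
    vcount y a <= (i * vcount y c)%N -> vcount z a <= (i.+1 * vcount z c)%N.
  move=> d yc ya; rewrite leqNgt; apply/negP => za.
  have pr : prefix (proj y z a) (spow n (proj y z c)).
    by rewrite -proj_spow e // proj_cat prefix_prefix.
  have := @prefix_spow_count _ _ _ _ i.+1 (fun l => l.1 == y) (fun l => l.1 == z) pr.
  by rewrite -!/(vcount _ _) !vcount_projl !vcount_projr => /(_ za); rewrite mulSn; lia.
(* Each new period allowed adds at least one vertex to this set, until it
   contains the whole support of [c]. *)
pose T i := [set z | (0 < vcount z c) && (vcount z a <= ((j + i) * vcount z c)%N)].
have TS i : T i \subset T i.+1.
  by apply/subsetP => z; rewrite !inE => /andP[-> /=]; rewrite addnS mulSn; lia.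
have grow i : (i < #|T i|) \/ forall z, 0 < vcount z c -> z \in T i.
  elim: i => [|i [IH|IH]].
  - by left; apply/card_gt0P; exists x; rewrite inE xc addn0.
  - case: (pselect (forall z, 0 < vcount z c -> z \in T i.+1)) => [|nT]; first by right.
    left; apply: leq_ltn_trans IH _; apply: proper_card.
    rewrite properE TS /=; apply/negP => /subsetP TT; apply: nT => z zc.
    apply: (subsetP (TS i)); move: z zc; apply: cc.
      exists x; rewrite // inE xc /=.
      by apply: leq_trans xa _; rewrite leq_mul2r leq_addr orbT.
    move=> y z yT yc zc d; apply: TT; rewrite inE zc addnS /=.
    by apply: step d yc _; move: yT; rewrite inE => /andP[].
  - by right => z zc; apply: (subsetP (TS i)); apply: IH.
have [|all] := grow #|V|; first by rewrite ltnNge max_card.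
by move=> y /all; rewrite inE => /andP[].
Qed.

(** For reduced [u], the elements joined to 1 in the Cayley graph by a geodesic
through [ev u]. *)
Definition cone u h := exists2 k, reduced (u ++ k) & h = ev (u ++ k).

Lemma cone_cat u v h : cone (u ++ v) h -> cone u h.
Proof. by case=> k r ->; exists (v ++ k); rewrite catA. Qed.

Lemma cone_mono m n c h : m <= n -> cone (spow n c) h -> cone (spow m c) h.
Proof. by move=> mn; rewrite -(subnKC mn) spow_add => /cone_cat. Qed.

Lemma cone_teq u v r t : reduced t -> teq t (u ++ r) -> cone u (ev t).
Proof. by move=> rt e; exists r; rewrite -?(teq_reduced e) // (teq_ev e). Qed.

(** Let [c^n = a b], where [b] is the part that cancels against a reduced word
for [h]. By [progress] either [a] goes past [M] periods at every letter, and
then [c^M] survives as a prefix of the product; or [a] stays within the first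
[M + #|V|] periods at every letter, and then [b] ends with [c^M], so that [h]
begins with [c^-M]. *)
Lemma dichotomy c M n h : pure_word c -> 2 * M + #|V| <= n ->
  ~ cone (spow M (inv_word c)) h -> cone (spow M c) (ev c ^+ n * h).
Proof.
move=> [c0 rc cc] Mn nh; have [t rt eh] := ev_reduced h; subst h.
have [a [b [t' [ec et rat]]]] := cancellation (rc n) rt.
have -> : ev c ^+ n * ev t = ev (a ++ t').
  by rewrite -evX (teq_ev ec) (teq_ev et) !evM evV -mulgA mulVKg.
have apre x y : dep x y -> prefix (proj x y a) (proj x y (spow n c)).
  by move=> d; rewrite (ec _ _ d) proj_cat prefix_prefix.
have cpre m x y : m <= n -> prefix (proj x y (spow m c)) (proj x y (spow n c)).
  by move=> mn; rewrite !proj_spow prefix_spow.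
have cnta x : vcount x a <= (n * vcount x c)%N.
  have := prefix_count (fun l => l.1 == x) (apre _ _ (dep_refl x)).
  by rewrite -!/(vcount _ _) !vcount_projl vcount_spow.
case: (pselect (exists2 x, 0 < vcount x c & vcount x a <= (M * vcount x c)%N)).
  move=> [x xc xa]; case: nh.
  have ya y : vcount y a <= ((M + #|V|) * vcount y c)%N.
    have [y0|] := posnP (vcount y c); last exact: (progress cc ec xc xa).
    by have := cnta y; rewrite y0 !muln0.
  have [r er] : exists r, teq (spow (M + #|V|) c) (a ++ r).
    apply: teq_prefix => x' y' d; apply: (@prefix_total _ _ _ (proj x' y' (spow n c))).
    + exact: apre.
    + by apply: cpre; lia.
    + by rewrite !size_proj !vcount_spow leq_add // leq_mul2l ya orbT.
  pose s := r ++ spow (n - (2 * M + #|V|)) c.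
  have eb : teq b (s ++ spow M c).
    apply/(teq_cat2l a)/(teq_trans (teq_sym ec)).
    rewrite (_ : n = M + #|V| + (n - (2 * M + #|V|) + M))%N; last by lia.
    rewrite (spow_add (M + _)) (spow_add _ M) /s !catA.
    by apply: teq_cat => //; apply: teq_cat.
  apply: (@cone_teq _ [::] (inv_word s ++ t')) => //.
  apply: teq_trans et _; rewrite catA; apply: teq_cat => //.
  apply: teq_trans (teq_inv eb) _.
  by rewrite inv_word_cat inv_word_spow.
move=> na; have [r er] : exists r, teq a (spow M c ++ r).
  apply: teq_prefix => x y d; apply: (@prefix_total _ _ _ (proj x y (spow n c))).
  - by apply: cpre; lia.
  - exact: apre.
  have ya y' : (M * vcount y' c)%N <= vcount y' a.
    have [->|y0] := posnP (vcount y' c); first by rewrite muln0.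
    by rewrite leqNgt; apply/negP => lt; apply: na; exists y'; rewrite // ltnW.
  by rewrite !size_proj !vcount_spow leq_add // leq_mul2l ya orbT.
exists (r ++ t'); last by rewrite catA; apply/teq_ev/teq_cat.
by rewrite catA -(teq_reduced (teq_cat er (@teq_refl _ t'))).
Qed.

(** A letter cancelling at the seam of [d] and [d^m k] would lie in [d]; as it
does not commute with itself it would cancel between two copies of [d]. *)
Lemma reduced_spow_cat d m n k : pure_word d -> 0 < m ->
  reduced (spow m d ++ k) -> reduced (spow (n + m) d ++ k).
Proof.
move=> [d0 rd _] m0 r; elim: n => [//|n IH].
rewrite addSn spowS -catA; apply: reduced_cat => // [|l sl].
  by have := rd 1%N; rewrite /spow /= cats0.
rewrite starts_cat => /orP[s|/andP[al _]].
  by apply: (reduced_catE _ sl s); rewrite -spowS.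
have := starts_mem sl; rewrite mem_inv => ld.
have : inv l \in spow (n + m) d.
  by case: (n + m)%N (addn_gt0 n m) => [|i _]; [rewrite m0 orbT | rewrite mem_cat ld].
by move/(allP al); rewrite /= adj_irrefl.
Qed.

Lemma cone_shift m n d h : cone (spow (m + n) d) h -> cone (spow n d) (ev d ^- m * h).
Proof.
case=> k; rewrite spow_add -catA => r ->; exists k; first exact: reduced_catr r.
by rewrite evM evX mulKg.
Qed.

Lemma wlen_shift m n d h : cone (spow (m + n) d) h ->
  wlen h = (m * size d + wlen (ev d ^- m * h)%g)%N.
Proof.
case=> k r eh; have := r; rewrite spow_add -catA => r'.
have -> : ev d ^- m * h = ev (spow n d ++ k).
  by rewrite eh spow_add -catA evM evX mulKg.
rewrite eh (wlenE r) (wlenE (reduced_catr r')).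
by rewrite spow_add -catA size_cat size_spow.
Qed.

Lemma wlen_unshift m n d h : pure_word d -> 0 < n -> cone (spow n (inv_word d)) h ->
  wlen (ev d ^- m * h)%g = (m * size d + wlen h)%N.
Proof.
move=> gd n0 [k r eh]; have := reduced_spow_cat m (pure_word_inv gd) n0 r => r'.
have -> : ev d ^- m * h = ev (spow (m + n) (inv_word d) ++ k).
  by rewrite eh spow_add -catA [RHS]evM -(inv_word_spow m) evV evX.
rewrite (wlenE r') eh (wlenE r).
by rewrite spow_add -catA !size_cat !size_spow !size_inv.
Qed.

Lemma conj_mulXV g p n h : (g ^ p) ^- n * (p^-1 * h) = p^-1 * (g ^- n * h).
Proof. by rewrite -conjXg -conjVg conjgE -!mulgA mulVKg. Qed.

Lemma conj_mulX g p n h : (g ^ p) ^+ n * (p^-1 * h) = p^-1 * (g ^+ n * h).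
Proof. by rewrite -conjXg conjgE -!mulgA mulVKg. Qed.

Lemma wlen_change p q h : wlen (p^-1 * h) <= wlen p + wlen q + wlen (q^-1 * h).
Proof.
rewrite -{1}(mulVKg q h) !mulgA -mulgA; apply: leq_trans (wlenM _ _) _.
by rewrite leq_add2r; apply: leq_trans (wlenM _ _) _; rewrite wlenV.
Qed.

(** Backward powers of [g] shorten the elements of a forward cone of [g] and
lengthen those of a backward cone; a change of base point costs a bounded
amount of length. *)
Lemma opposite_cones g p q d d' n m h : pure_word d -> pure_word d' ->
  g ^ p = ev d -> g ^ q = ev d' -> 0 < m -> (wlen p + wlen q).*2 < n ->
  cone (spow n d) (p^-1 * h) -> cone (spow m (inv_word d')) (q^-1 * h) -> False.
Proof.
move=> gd gd' gp gq m0 nn; rewrite -[n in spow n](addn0 n) => /wlen_shift.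
move=> e1 /(wlen_unshift n gd' m0); move: e1.
rewrite -gp -gq !conj_mulXV => e1 e2.
have := wlen_change q p (g ^- n * h); have := wlen_change p q h.
have [d0 _ _] := gd.
have : (n <= n * size d)%N by rewrite leq_pmulr.
by lia.
Qed.

(** A deep cone along [g] read off from one conjugate lies in a cone read off
from another one. Go back from [h] by a power of [g], short enough to remain in
the first cone, hence outside the opposite cones; by [dichotomy] coming forward
again leads into the second cone. *)
Lemma change_cone g p q d d' m : pure_word d -> pure_word d' ->
  g ^ p = ev d -> g ^ q = ev d' -> 0 < m ->
  exists n0, forall n h, n0 <= n ->
    cone (spow n d) (p^-1 * h) -> cone (spow m d') (q^-1 * h).
Proof.
move=> gd gd' gp gq m0; pose i := (2 * m + #|V|)%N.
exists (i + ((wlen p + wlen q).*2).+1)%N => n h le /(cone_mono le) /cone_shift.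
rewrite -gp conj_mulXV => cp.
have -> : q^-1 * h = ev d' ^+ i * (q^-1 * (g ^- i * h)).
  by rewrite -gq conj_mulX mulVKg.
apply: (@dichotomy _ m) => // cn.
exact: (opposite_cones gd gd' gp gq m0 (leqnn _) cp cn).
Qed.

End Cones.

(** * Periodic prefixes of a list *)

Section PeriodicPrefixes.
Variable T : eqType.
Implicit Types (u v s l : seq T) (P : pred T) (n : nat).

Lemma sub_period n u v s l : prefix (spow n u) l -> prefix (s ++ v) l ->
  0 < size u -> size s + size v <= n -> {subset s ++ v <= u}.
Proof.
move=> pu pv u0 sn x xs; apply: (@mem_spow _ n).
have /prefixP[r ->] : prefix (s ++ v) (spow n u).
  apply: prefix_total pv pu _; rewrite size_cat size_spow.
  by apply: leq_trans sn _; rewrite leq_pmulr.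
by rewrite mem_cat xs.
Qed.

(** If [P] occurred in [u], it would occur at least [(size s).+1] times in the
first [(size s).+1] periods of [u], but only [s] can provide occurrences on
the other side. *)
Lemma period_count0 n u v s l P : prefix (spow n u) l -> prefix (s ++ spow n v) l ->
  0 < size v -> (size s).+1 * size u <= n -> count P v = 0%N -> count P u = 0%N.
Proof.
move=> pu pv v0 sn Pv.
have [u0|u0] := posnP (size u); first by rewrite (size0nil u0).
have pu' : prefix (spow (size s).+1 u) l.
  apply: prefix_trans pu; apply: prefix_spow; apply: leq_trans sn.
  by rewrite leq_pmulr.
have /(prefix_count P) : prefix (spow (size s).+1 u) (s ++ spow n v).
  apply: prefix_total pu' pv _; rewrite size_cat !size_spow.
  apply: leq_trans sn _; apply: leq_trans (leq_addl _ _).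
  by rewrite leq_pmulr.
rewrite count_cat !count_spow Pv muln0 addn0.
have := count_size P s; case: (count P u) => // m; nia.
Qed.

(** Both periods have the same density of [P]. Powers of [u] and [v] of equal
length, [(size s).+1 * size u * size v], are offset by [s], so their counts
differ by at most [size s], while a difference of densities would be
multiplied by [(size s).+1]. *)
Lemma period_density n u v s l P : prefix (spow n u) l -> prefix (s ++ spow n v) l ->
  (size s).+1 * size u <= n -> (size s).+1 * size v <= n ->
  (size v * count P u = size u * count P v)%N.
Proof.
move=> pu pv un vn; set A := size u; set B := size v; set i := (size s).+1.
have pu' : prefix (spow (i * B) u) l by apply: prefix_trans (prefix_spow _ vn) pu.
have pv' : prefix (s ++ spow (i * A) v) l.
  apply: prefix_trans pv; rewrite -(subnKC un) spow_add catA; exact: prefix_prefix.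
have /prefixP[r er] : prefix (spow (i * B) u) (s ++ spow (i * A) v).
  by apply: prefix_total pu' pv' _; rewrite size_cat !size_spow -!/(A) -!/(B); nia.
have sr : size r = size s.
  have := congr1 size er; rewrite !size_cat !size_spow -!/(A) -!/(B); nia.
have := congr1 (count P) er; rewrite !count_cat !count_spow.
have := count_size P r; have := count_size P s; rewrite sr /i.
move: (count P s) (count P r) (count P u) (count P v) (size s) => a b x y k.
by move=> ak bk; rewrite -!mulnA; move: (B * x)%N (A * y)%N => X Y; nia.
Qed.

(** Shifting the list by one period of [u] also puts [s] one period further;
both sides are then prefixes of the list, of the same length. *)
Lemma period_conj u v s l : size u = size v ->
  prefix (spow (size s).+1 u) l -> prefix (s ++ v) l -> u ++ s = s ++ v.
Proof.
move=> uv pu pv.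
have [u0|u0] := posnP (size u).
  by rewrite (size0nil u0) (@size0nil _ v) ?cats0 -?uv.
apply: (@prefix_eq _ _ _ l) => //; last by rewrite !size_cat uv addnC.
apply: (prefix_trans _ pu); rewrite spowS.
have : prefix s (spow (size s) u).
  apply: (@prefix_total _ _ _ l).
  - exact: prefix_trans (prefix_prefix _ _) pv.
  - by apply: (prefix_trans _ pu); apply: prefix_spow.
  - by rewrite size_spow leq_pmulr.
by case/prefixP => r ->; rewrite catA prefix_prefix.
Qed.

End PeriodicPrefixes.

(** * Cones of two elements that meet *)

Section TwoCones.
Variable L : sgraph.
Implicit Types (u v w c d q k e : word L) (l : letter L) (x y z : vertex L).
Implicit Types (g h p : raag L) (a b : letter L) (s t : bool).
Local Notation inv := (@inv_letter L).
Local Notation V := (vertex L).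

Definition all_adj u v := forall a b : letter L, a \in u -> b \in v -> adj a.1 b.1.

Lemma teq_filter (P : pred (letter L)) u :
  all_adj (filter P u) (filter (predC P) u) ->
  teq u (filter P u ++ filter (predC P) u).
Proof.
elim: u => [//|a u IH] /=; case: ifP => Pa /= h.
  by apply/teq_cons2/IH => m n mu nu; apply: h; rewrite // inE mu orbT.
apply: (@teq_trans _ ([:: a] ++ filter P u ++ filter (predC P) u)).
  by apply/teq_cons2/IH => m n mu nu; apply: h; rewrite // inE nu orbT.
rewrite -(cat1s a (filter (predC P) u)) !catA; apply: teq_cat => //.
apply: teq_commute => m n; rewrite inE => /eqP -> nu.
by rewrite adj_sym h // mem_head.
Qed.

Lemma commute_adj u v : all_adj u v -> commute (ev u) (ev v).
Proof. by move=> uv; rewrite /commute -!evM; apply/teq_ev/teq_commute. Qed.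

(** On every noncommuting pair the two powers give two periodic prefixes of
one list. If the supports of [c] and [d] do not commute entirely, then by
connectedness they coincide and the periods have proportional lengths, so
suitable powers are conjugate by [q]. Otherwise, a letter of [q] outside the
support of [c] commutes with [c], and a letter inside it commutes with [d]
and can be dropped. *)
Lemma two_powers c d q k k' n : pure_word c -> pure_word d ->
  (size q).+1 * (size c + size d) <= n ->
  teq (spow n c ++ k) (q ++ spow n d ++ k') ->
  (exists i j, [/\ 0 < i, 0 < j & teq (spow i c ++ q) (q ++ spow j d)]) \/
  (exists2 e, all_adj e c & ev e = ev (q ++ d ++ inv_word q)).
Proof.
move=> [c0 rc cc] [d0 rd cd] nn E.
have n0 : 0 < n by apply: leq_trans nn; rewrite mulSn; lia.
pose l x y := proj x y (spow n c ++ k).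
have pc x y : prefix (spow n (proj x y c)) (l x y).
  by rewrite /l proj_cat proj_spow prefix_prefix.
have pd x y : dep x y -> prefix (proj x y q ++ spow n (proj x y d)) (l x y).
  by move=> D; rewrite /l E // !proj_cat proj_spow catA prefix_prefix.
have pd1 m x y : dep x y -> m <= n ->
    prefix (proj x y q ++ spow m (proj x y d)) (l x y).
  move=> D mn; apply: prefix_trans (pd _ _ D).
  by rewrite -(subnKC mn) spow_add catA prefix_prefix.
have sp x y w : size (proj x y w) <= size w by rewrite size_filter count_size.
have sub x y : dep x y -> 0 < vcount x c ->
    {subset proj x y q ++ proj x y d <= proj x y c}.
  move=> D xc; apply: (@sub_period _ n _ _ _ (l x y)) => //.
  - by have := pd1 1%N _ _ D n0; rewrite /spow /= cats0.
  - by apply: leq_trans xc _; rewrite -(vcount_projl x y) count_size.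
  - apply: leq_trans nn; rewrite mulSn addnC leq_add //.
      by apply: leq_trans (sp x y d) _; rewrite leq_addl.
    by apply: leq_trans (sp x y q) _; rewrite leq_pmulr // addn_gt0 c0.
(* Dependent letters of [c] and [d] force each other into the other word: over
   this pair the two projections have to agree far beyond one period. *)
have clash x y : dep x y -> 0 < vcount x c -> 0 < vcount y d ->
    0 < vcount y c /\ 0 < vcount x d.
  move=> D xc yd; split.
    move: yd; rewrite -(vcount_projr x y) => /mem_vcount[b bd <-].
    have : b \in proj x y c by apply: sub => //; rewrite mem_cat bd orbT.
    by rewrite mem_filter => /andP[_ /vcount_mem].
  rewrite lt0n -(vcount_projl x y); apply/negP => /eqP x0.
  have : vcount x (proj x y c) = 0%N.
    apply: (period_count0 (pc x y) (pd _ _ D) _ _ x0).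
    - by apply: leq_trans yd _; rewrite -(vcount_projr x y) count_size.
    - apply: leq_trans nn; apply: leq_mul; first by rewrite ltnS sp.
      by apply: leq_trans (sp x y c) _; rewrite leq_addr.
  by rewrite vcount_projl => x0'; rewrite x0' in xc.
case: (pselect (exists x y, [/\ dep x y, 0 < vcount x c & 0 < vcount y d])); last first.
  move=> none; right.
  have cdadj : all_adj c d.
    move=> a b ac bd; apply/negPn/negP => D; apply: none.
    by exists a.1, b.1; split; rewrite ?vcount_mem.
  pose P := fun a : letter L => vcount a.1 c == 0%N.
  have qadj a b : a \in q -> P a -> b \in c -> adj a.1 b.1.
    move=> aq /eqP a0 bc; apply/negPn/negP; rewrite -/(dep _ _) dep_sym => D.
    have : a \in proj b.1 a.1 c.
      apply: (sub _ _ D (vcount_mem bc)).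
      by rewrite mem_cat mem_filter aq eqxx orbT.
    by rewrite mem_filter => /andP[_ /vcount_mem]; rewrite a0.
  have inc a : ~~ P a -> exists2 b, b \in c & b.1 = a.1.
    by rewrite /P -lt0n => /mem_vcount.
  have /teq_ev : teq q (filter P q ++ filter (predC P) q).
    apply: teq_filter => a b; rewrite !mem_filter => /andP[Pa aq] /andP[/inc[b' b'c <-] _].
    exact: qadj.
  rewrite evM => eq; exists (filter P q ++ d ++ inv_word (filter P q)).
    move=> a b + bc; rewrite !mem_cat mem_inv => /or3P[|ad|].
    + by rewrite mem_filter => /andP[Pa aq]; apply: qadj.
    + by rewrite adj_sym cdadj.
    + by rewrite mem_filter => /andP[Pa aq]; apply: (qadj (inv a)).
  have : commute (ev (filter (predC P) q)) (ev d).
    apply: commute_adj => a b; rewrite mem_filter => /andP[/inc[a' a'c <-] _].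
    exact: cdadj.
  rewrite !evM !evV eq invgM => com.
  rewrite -!mulgA; congr (_ * _).
  by rewrite (mulgA (ev (filter (predC P) q))) com -mulgA mulVKg.
move=> [x [y [xy xc yd]]]; left.
have [yc xd] := clash _ _ xy xc yd.
have cSd z : 0 < vcount z c -> 0 < vcount z d.
  move=> zc; suff : z \in [set z | 0 < vcount z d] by rewrite inE.
  apply: cc zc; first by exists x; rewrite ?inE.
  move=> a b; rewrite !inE => ad ac bc D.
  by have [] := clash b a; rewrite // dep_sym.
have dSc z : 0 < vcount z d -> 0 < vcount z c.
  move=> zd; suff : z \in [set z | 0 < vcount z c] by rewrite inE.
  apply: cd zd; first by exists x; rewrite ?inE.
  by move=> a b; rewrite !inE => ac ad bd D; have [] := clash a b.
(* Now [c] and [d] have the same letters, in constant proportion. *)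
have ratio (a b : V) : dep a b -> (vcount a c * vcount b d = vcount a d * vcount b c)%N.
  move=> D; have := @period_density _ n _ _ _ _ (fun l => l.1 == a) (pc a b) (pd _ _ D).
  rewrite -!/(vcount _ _) !vcount_projl !size_proj => h.
  case: (eqVneq a b) h => [->|ab] h; first by rewrite mulnC.
  have := h _ _; rewrite !mul1n => {}h.
  suff : ((vcount a d + vcount b d) * vcount a c =
          (vcount a c + vcount b c) * vcount a d)%N by nia.
  have sz w : vcount a w + vcount b w <= size w.
    by have := sp a b w; rewrite size_proj ab mul1n.
  by apply: h; apply: leq_trans nn; apply: leq_mul; rewrite ?ltnS -?size_proj ?sp //;
    apply: leq_trans (sz _) _; rewrite ?leq_addr ?leq_addl.
have prop z : (vcount x d * vcount z c = vcount x c * vcount z d)%N.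
  have [z0|zc] := posnP (vcount z c).
    by have [->|/dSc] := posnP (vcount z d); rewrite z0 ?muln0.
  suff : z \in [set z | (vcount x d * vcount z c == vcount x c * vcount z d)%N].
    by rewrite inE => /eqP.
  apply: cc zc; first by exists x; rewrite // inE mulnC.
  move=> a b; rewrite !inE => /eqP ea ac bc D; have := ratio _ _ D.
  move=> eb; rewrite -(eqn_pmul2l (cSd _ ac)); apply/eqP.
  by rewrite mulnCA -eb (mulnA (vcount x d)) ea -mulnA mulnCA.
(* These exponents give both powers the same number of occurrences of each
   vertex, hence projections of equal lengths. *)
exists (vcount x d), (vcount x c); split=> // a b D.
have cs w z : vcount z w <= size w by apply: count_size.
rewrite !proj_cat !proj_spow; apply: (@period_conj _ _ _ _ (l a b)).
- by rewrite !size_spow !size_proj !mulnDr !mulnA !(mulnC _ (a != b)) -!mulnA !prop.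
- apply: prefix_trans (pc a b); rewrite spow_mul; apply: prefix_spow.
  apply: leq_trans nn; apply: leq_mul; first by rewrite ltnS sp.
  by apply: leq_trans (cs _ _) _; rewrite leq_addl.
- apply: pd1 => //; apply: leq_trans nn; rewrite mulSn.
  by apply: leq_trans (cs _ _) _; rewrite -addnA leq_addr.
Qed.

(** If [q ++ spow n d ++ k] were not reduced, a letter of [q] would cancel
either into [d], or across it into [k]; in the second case it commutes with
[d] and cancels with its own inverse in [q ++ d ++ inv_word q]. *)
Lemma reduced_conj_cat q d n k : reduced (q ++ d ++ inv_word q) -> 0 < n ->
  reduced (spow n d ++ k) -> reduced (q ++ spow n d ++ k).
Proof.
move=> + n0 rk; elim: q => [//|l q IH] /=.
rewrite inv_word_cons => /andP[sl rq]; rewrite IH ?andbT; last first.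
  by move: rq; rewrite !catA => /reduced_catl.
apply/negP; move: sl; rewrite !starts_cat !negb_or /= eqxx /= andbT.
case/andP=> /negPf-> /=; rewrite negb_and => /orP[/negPf-> //|].
case: n n0 {IH rk rq} => // n _; rewrite spowS starts_cat negb_or.
case/andP => /negPf -> /= h /andP[aq /orP[/andP[ad /starts_mem/mem_spow sd]|]].
  by have := allP ad _ sd; rewrite adj_irrefl.
rewrite all_cat => /andP[/andP[ad _] _]; move: h; rewrite ad /= => /norP[_ /negP[]].
by apply/allP => b; rewrite mem_inv => /(allP aq).
Qed.

(** Cones come in pairs, along [c] and along its inverse; a boolean sign, with
the same meaning as in letters, selects one of the two. *)
Definition sword s c := if s then inv_word c else c.

Definition signed (G : groupType) s (g : G) := if s then g^-1 else g.

Lemma signedX (G : groupType) s (g : G) n : signed s (g ^+ n) = signed s g ^+ n.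
Proof. by case: s; rewrite /= ?expVgn. Qed.

Lemma swordK s : involutive (sword s).
Proof. by case: s => c //=; rewrite inv_wordK. Qed.

Lemma sword_negb s c : sword (~~ s) c = inv_word (sword s c).
Proof. by case: s => //=; rewrite inv_wordK. Qed.

Lemma pure_word_sword s c : pure_word c -> pure_word (sword s c).
Proof. by case: s => //=; apply: pure_word_inv. Qed.

Lemma size_sword s c : size (sword s c) = size c.
Proof. by case: s => //=; rewrite size_inv. Qed.

Lemma ev_sword s c : ev (sword s c) = signed s (ev c).
Proof. by case: s => //=; rewrite evV. Qed.

Lemma signed_conj g p c s : g ^ p = ev c -> signed s g ^ p = ev (sword s c).
Proof. by rewrite ev_sword; case: s => //= <-; rewrite conjVg. Qed.

Lemma all_adj_sword s t e c : all_adj e c -> all_adj (sword s e) (sword t c).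
Proof.
move=> ec a b ae bc.
have mem (l : letter L) r u : l \in sword r u -> exists2 k, k \in u & k.1 = l.1.
  by case: r => /= lu; [exists (inv l); rewrite -?mem_inv | exists l].
have [a' a'e <-] := mem _ _ _ ae; have [b' b'c <-] := mem _ _ _ bc.
exact: ec.
Qed.

Lemma conj_ev g q d : g = ev (q ++ d ++ inv_word q) -> g ^ ev q = ev d.
Proof. by move=> ->; rewrite !evM evV conjgE !mulgA mulVg mul1g mulgVK. Qed.

Definition common_power g h :=
  exists m n : int, [/\ m != 0%R, n != 0%R & expgz g m = expgz h n].

Lemma expgz_signed g s i : 0 < i ->
  exists2 m : int, m != 0%R & expgz g m = signed s g ^+ i.
Proof.
case: s; last by exists (Posz i) => //; lia.
by case: i => // i _; exists (Negz i); rewrite //= expVgn.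
Qed.

(** Signed form of [two_powers]. The bound on [n] is the same for all signs,
as [commuting_adj] requires. *)
Lemma meet_cones c d q s t n h : pure_word c -> pure_word d ->
  reduced (q ++ d ++ inv_word q) ->
  (size q).+1 * (size c + size d) <= n ->
  cone (spow n (sword s c)) h -> cone (spow n (sword t d)) ((ev q)^-1 * h) ->
  common_power (ev c) (ev (q ++ d ++ inv_word q)) \/
  exists2 e, all_adj e c & ev e = ev (q ++ d ++ inv_word q).
Proof.
move=> gc gd rq nn [k rk eh] [k' rk' eh'].
have n0 : 0 < n.
  by case: gc => c0 _ _; apply: leq_trans nn; rewrite mulSn; lia.
have rqt : reduced (q ++ sword t d ++ inv_word q).
  case: t {rk' eh'} => //; move/reduced_inv: rq.
  by rewrite !inv_word_cat inv_wordK catA.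
have E : teq (spow n (sword s c) ++ k) (q ++ spow n (sword t d) ++ k').
  apply: reduced_teq => //; first exact: reduced_conj_cat.
  by rewrite -eh [RHS]evM -eh' mulVKg.
have gq := signed_conj t (conj_ev (erefl (ev (q ++ d ++ inv_word q)))).
have := two_powers (pure_word_sword s gc) (pure_word_sword t gd) _ E.
rewrite !size_sword => /(_ nn) [[i [j [i0 j0 /teq_ev]]]|[e ec ee]]; last first.
  right; exists (sword t e); first by rewrite -(swordK s c); apply: all_adj_sword.
  apply: (@conjg_inj _ (ev q)).
  by rewrite ev_sword ee (signed_conj t (conj_ev (erefl _))) swordK (conj_ev (erefl _)).
rewrite [LHS]evM [RHS]evM !evX => eq; left.
have [m m0 em] := expgz_signed (ev c) s i0.
have [m' m'0 em'] := expgz_signed (ev (q ++ d ++ inv_word q)) t j0.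
exists m, m'; split=> //; rewrite em em'; apply: (@conjg_inj _ (ev q)).
by rewrite [RHS]conjXg gq -ev_sword conjgE eq mulKg.
Qed.

Lemma cone_adj e u h : all_adj e u -> cone u h -> cone u (ev e * h).
Proof.
elim: e => [|l e IH] eu cu; first by rewrite mul1g.
rewrite ev_cons -mulgA.
have [a b ae bu|k rk ->] := IH _ cu; first by rewrite eu // inE ae orbT.
have lu : all_adj [:: l] u.
  by move=> a b; rewrite inE => /eqP-> ; apply: eu; rewrite mem_head.
have lu' : all_adj [:: inv l] u.
  by move=> a b; rewrite inE => /eqP-> ; apply: (lu l); rewrite mem_head.
case: (boolP (starts k (inv l))) => sk.
  exists (rem (inv l) k).
    have := rk; rewrite (teq_reduced (teq_cat (teq_refl u) (teq_rem sk))).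
    rewrite -cat1s catA -(teq_reduced (teq_cat (teq_commute lu') (teq_refl _))).
    by move=> /= /andP[].
  rewrite -evM catA (teq_ev (teq_cat (teq_commute lu) (teq_refl k))).
  rewrite -catA !evM (teq_ev (teq_rem sk)) (ev_cons (inv l) (rem _ _)).
  by rewrite ev_invl mulVKg.
exists (l :: k).
  rewrite -cat1s catA -(teq_reduced (teq_cat (teq_commute lu) (teq_refl k))) /= rk andbT.
  rewrite starts_cat (negPf sk) andbF orbF; apply/negP => /starts_mem lu''.
  by have := eu _ _ (mem_head l e) lu''; rewrite adj_irrefl.
by rewrite -evM catA (teq_ev (teq_cat (teq_commute lu) (teq_refl k))) -catA.
Qed.

(** By [dichotomy], high powers of [ev c] and of [g := q d q^-1] push points into
the cones along them, unless these points are in the opposite cones. Since the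
two commute, moving [q d^n] by both leads in all cases to a point that lies in
one of the two cones of [ev c] and in one of those of [g], so that [meet_cones]
applies. *)
Lemma commuting_adj c d q : pure_word c -> pure_word d ->
  reduced (q ++ d ++ inv_word q) ->
  commute (ev c) (ev (q ++ d ++ inv_word q)) ->
  ~ common_power (ev c) (ev (q ++ d ++ inv_word q)) ->
  exists2 e, all_adj e c & ev e = ev (q ++ d ++ inv_word q).
Proof.
set g := ev (q ++ _) => gc gd rq com ncp.
pose n := ((size q).+1 * (size c + size d))%N; pose N := (2 * n + #|V|)%N.
have meet s t h : cone (spow n (sword s c)) h ->
    cone (spow n (sword t d)) ((ev q)^-1 * h) ->
    exists2 e, all_adj e c & ev e = g.
  by move=> h1 h2; have [] := meet_cones gc gd rq (leqnn _) h1 h2.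
have gq : g ^ ev q = ev d by exact: conj_ev.
have qd m : cone (spow n d) ((ev q)^-1 * ev (q ++ spow (n + m) d)).
  rewrite evM mulKg; exists (spow m d); rewrite -spow_add //.
  by case: gd => _ + _; apply.
pose y := ev (q ++ spow (n + 0) d).
case: (pselect (cone (spow n (inv_word c)) y)) => [yc|nyc].
  exact: (meet true false _ yc (qd 0%N)).
have xc := dichotomy gc (leqnn N) nyc; set x := _ * y in xc.
case: (pselect (cone (spow n (inv_word d)) ((ev q)^-1 * x))) => [xd|nxd].
  exact: (meet false true _ xc xd).
have gxd := dichotomy gd (leqnn N) nxd.
rewrite -gq conj_mulX in gxd.
have gy : g ^+ N * y = ev (q ++ spow (n + N) d).
  rewrite /y addn0 addnC spow_add !evM !evX -(mulVKg (ev q) (g ^+ N * _)).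
  by rewrite -conj_mulX gq mulKg.
case: (pselect (cone (spow n (inv_word c)) (g ^+ N * y))) => [gyc|ngyc].
  by apply: (meet true false _ gyc); rewrite gy; apply: qd.
apply: (meet false false _ _ gxd).
have -> : g ^+ N * x = ev c ^+ N * (g ^+ N * y).
  by rewrite /x !mulgA (commuteX2 _ _ (commute_sym com)).
exact: dichotomy.
Qed.

(** * Cyclic reduction and purity *)

(** Strip from [w] a first letter and an equal inverse last letter, as long as
there are any. *)
Lemma conj_form w : reduced w -> exists q d,
  teq w (q ++ d ++ inv_word q) /\ forall l, starts (inv_word d) l -> starts d l -> False.
Proof.
have [n] := ubnP (size w); elim: n w => [//|n IH] w wn rw.
case: (pselect (exists2 l, starts (inv_word w) l & starts w l)); last first.
  move=> no; exists [::], w; split; first by rewrite /= cats0.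
  by move=> l l1 l2; apply: no; exists l.
move=> [l l1 l2]; have ew := teq_rem l2; set w1 := rem l w in ew.
have : starts (inv_word w1) l.
  move: l1; rewrite (teq_starts _ (teq_inv ew)) inv_word_cons starts_cat /=.
  by rewrite inv_letter_neq andbF orbF andbF orbF.
case/starts_inv => w2 ew1.
have ew2 : teq w (l :: w2 ++ [:: inv l]) by apply: teq_trans ew _; apply/teq_cons2.
have [||q [d [e h]]] := IH w2.
- by move: wn; rewrite (teq_size ew2) /= size_cat /=; lia.
- by move: rw; rewrite (teq_reduced ew2) => /= /andP[_ /reduced_catl].
exists (l :: q), d; split=> //.
apply: teq_trans ew2 _; rewrite inv_word_cons /= !catA; apply/teq_cons2.
by apply: teq_cat => //; rewrite -catA.
Qed.

Lemma cyc_reduced_spow d n : reduced d ->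
  (forall l, starts (inv_word d) l -> starts d l -> False) -> reduced (spow n d).
Proof.
move=> rd h; elim: n => [//|n IH]; rewrite spowS; apply: reduced_cat => // l sl.
case: n IH => [//|n] _; rewrite spowS starts_cat => /orP[|/andP[ad /starts_mem]].
  exact: h.
by move=> /mem_spow/(allP ad); rewrite adj_irrefl.
Qed.

Lemma wlenX g n : wlen (g ^+ n) <= n * wlen g.
Proof.
elim: n => [|n IH]; first by rewrite expg0; apply: (wlen_min [::]).
by rewrite expgS mulSn; apply: leq_trans (wlenM _ _) _; rewrite leq_add2l.
Qed.

(** Conjugation changes the length of every power by the same bounded
amount, while the lengths of the powers of [d] grow by exactly [size d]. *)
Lemma cyc_reduced_min d : (forall n, reduced (spow n d)) -> cyclically_reduced (ev d).
Proof.
move=> rd x; rewrite leqNgt; apply/negP => lt.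
pose n := ((wlen x).*2).+1.
have : wlen (ev d ^+ n) <= wlen x + (n * wlen (ev d ^ x) + wlen x).
  have -> : ev d ^+ n = x * ((ev d ^ x) ^+ n * x^-1).
    by rewrite -conjXg conjgE !mulgA mulgV mul1g mulgK.
  apply: leq_trans (wlenM _ _) _; rewrite leq_add2l.
  by apply: leq_trans (wlenM _ _) _; rewrite wlenV leq_add2r wlenX.
rewrite -evX (wlenE (rd n)) size_spow.
have := rd 1%N; rewrite /spow /= cats0 => /wlenE ed.
rewrite ed in lt.
have : n * (wlen (ev d ^ x)).+1 <= n * size d by rewrite leq_mul2l lt orbT.
by rewrite mulnS {1}/n; move: (n * size d)%N (n * wlen _)%N => a b; lia.
Qed.

Lemma reduced_eq1 u : reduced u -> ev u = 1 -> u = [::].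
Proof. by move=> ru eu; apply: size0nil; rewrite -(wlenE ru) eu; apply: (@wlenE _ [::]). Qed.

Lemma supp_reduced u x : reduced u -> x \in supp (ev u) -> 0 < vcount x u.
Proof.
move=> ru; rewrite inE => /asboolP[w [s [[ew sw] xw]]].
have rw : reduced w by rewrite reducedE sw ew.
by rewrite (teq_mem (reduced_teq rw ru ew)) in xw; apply: (vcount_mem xw).
Qed.

(** A set of letters of [d] closed under dependence commutes with the others, so
sorting [d] accordingly exhibits a splitting. *)
Lemma nonsplit_dep_connected d : reduced d -> ~ splits (ev d) -> dep_connected d.
Proof.
move=> rd ns T [x xT xd] h y yd; apply: contrapT => yT; apply: ns.
pose P := fun a : letter L => a.1 \in T.
have PP : all_adj (filter P d) (filter (predC P) d).
  move=> a b; rewrite !mem_filter => /andP[Pa ad] /andP[/negP Pb bd].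
  by apply/negPn/negP => D; apply: Pb; apply: h D => //; apply: vcount_mem.
have e := teq_filter PP; have re := rd; rewrite (teq_reduced e) in re.
have ru := reduced_catl re; have rv := reduced_catr re.
exists (filter P d), (filter (predC P) d); split.
- by split; [rewrite (teq_ev e) | rewrite (wlenE rd) (teq_size e)].
- apply/eqP => /(reduced_eq1 ru) /eqP; rewrite -size_eq0 size_filter eqn0Ngt -has_count.
  by have [a ad ax] := mem_vcount xd; move/hasPn/(_ a ad); rewrite /P ax xT.
- apply/eqP => /(reduced_eq1 rv) /eqP; rewrite -size_eq0 size_filter eqn0Ngt -has_count.
  have [a ad ay] := mem_vcount yd; move/hasPn/(_ a ad); rewrite /= /P ay negbK.
  by apply/negP/negP.
- exact: commute_adj.
- rewrite disjoint_subset; apply/subsetP => z /(supp_reduced ru)/mem_vcount[a].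
  rewrite mem_filter => /andP[Pa _] az; rewrite inE; apply/negP.
  move=> /(supp_reduced rv)/mem_vcount[b]; rewrite mem_filter => /andP[Pb _] bz.
  by move: Pb; rewrite /= /P bz -az -/(P a) Pa.
Qed.

Lemma pure_form g : pure g -> exists q d,
  [/\ pure_word d, reduced (q ++ d ++ inv_word q) & g = ev (q ++ d ++ inv_word q)].
Proof.
move=> [g1 gs]; have [w rw eg] := ev_reduced g; subst g.
have [q [d [e h]]] := conj_form rw.
have rq := rw; rewrite (teq_reduced e) in rq.
have rd : reduced d by move: rq => /reduced_catr/reduced_catl.
have rdn n := cyc_reduced_spow n rd h.
exists q, d; split=> //; last exact: teq_ev.
have gq : ev w ^ ev q = ev d by apply: conj_ev; apply: teq_ev.
split=> //.
  rewrite lt0n size_eq0; apply/eqP => d0.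
  by move: g1; rewrite -(conjg_eq1 _ (ev q)) gq d0 eqxx.
apply: nonsplit_dep_connected; rewrite -?gq //; apply: gs; rewrite gq.
exact: cyc_reduced_min.
Qed.

Lemma pure_conj g p : pure g -> pure (g ^ p).
Proof.
move=> [g1 h]; split; first by rewrite conjg_eq1.
by move=> x; rewrite -conjgM; apply: h.
Qed.

End TwoCones.

(** * The four ping-pong conditions *)

Section Pairs.
Variable L : sgraph.
Implicit Types (c d q e : word L) (g h p : raag L) (s t : bool).
Local Notation V := (vertex L).

Lemma expgzJ g p m : expgz (g ^ p) m = expgz g m ^ p.
Proof. by case: m => n /=; rewrite -conjXg ?conjVg. Qed.

Lemma common_powerJ g h p : common_power (g ^ p) (h ^ p) -> common_power g h.
Proof.
by move=> [m [n [m0 n0]]]; rewrite !expgzJ => /conjg_inj E; exists m, n.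
Qed.

Lemma commuteJ g h p : commute (g ^ p) (h ^ p) <-> commute g h.
Proof. by rewrite /commute -!conjMg; split=> [/conjg_inj|->]. Qed.

(** Only [c1] may be taken at the base point: conjugating by [p1] changes the
reduced form [q d q^-1] of [g2], and [change_cone] compares the cones given by
[p2] and [c2] with those given by [q] and [d]. *)
Lemma far_cones g1 g2 p1 p2 c1 c2 : pure_word c1 -> pure_word c2 -> pure g2 ->
  g1 ^ p1 = ev c1 -> g2 ^ p2 = ev c2 ->
  ~ common_power g1 g2 -> ~ commute g1 g2 ->
  exists m, forall n, m <= n -> forall s t h,
    cone (spow n (sword s c1)) (p1^-1 * h) ->
    cone (spow n (sword t c2)) (p2^-1 * h) -> False.
Proof.
move=> gc1 gc2 pg2 e1 e2 ncp ncom.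
have [q [d [gd rq eq]]] := pure_form (pure_conj p1 pg2).
have ed : g2 ^ (p1 * ev q) = ev d by rewrite conjgM; apply: conj_ev.
pose m := ((size q).+1 * (size c1 + size d))%N.
have m0 : 0 < m by case: gc1 => c0 _ _; rewrite muln_gt0 addn_gt0 c0.
have change t := change_cone (pure_word_sword t gc2) (pure_word_sword t gd)
  (signed_conj t e2) (signed_conj t ed) m0.
have [n0 h0] := change false; have [n1 h1] := change true.
exists (m + n0 + n1)%N => n le s t h k1 k2.
have mn : m <= n by lia.
have k3 : cone (spow m (sword t d)) ((ev q)^-1 * (p1^-1 * h)).
  rewrite mulgA -invgM; case: t k2 => k2; [apply: h1 k2 | apply: h0 k2]; lia.
have [] := meet_cones gc1 gd rq (leqnn _) (cone_mono mn k1) k3; rewrite -eq -?e1.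
  by move/common_powerJ.
move=> [e ec ee]; apply: ncom; apply/(commuteJ _ _ p1).
by rewrite e1 -ee; apply/commute_sym/commute_adj.
Qed.

(** [g2 ^ p] is a product of letters that commute with [c]; they can be pushed
past the initial power of [c]. *)
Lemma commuting_cone g1 g2 p c : pure_word c -> pure g2 -> g1 ^ p = ev c ->
  ~ common_power g1 g2 -> commute g1 g2 ->
  forall m n s t h, cone (spow m (sword s c)) (p^-1 * h) ->
    cone (spow m (sword s c)) (p^-1 * (signed t g2 ^+ n * h)).
Proof.
move=> gc pg2 e1 ncp com m n s t h ch.
have [q [d [gd rq eq]]] := pure_form (pure_conj p pg2).
have [||e ec ee] := commuting_adj gc gd rq.
- by rewrite -e1 -eq; apply/commuteJ.
- by rewrite -e1 -eq => /common_powerJ.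
rewrite -conj_mulX (signed_conj t (c := e)); last by rewrite ee.
rewrite -evX; apply: cone_adj ch => a b /mem_spow ae /mem_spow bc.
exact: (all_adj_sword ec ae bc).
Qed.

Lemma shallow_cone p c n s : pure_word c -> wlen p < n ->
  ~ cone (spow n (sword s c)) (p^-1 * 1).
Proof.
move=> [c0 _ _] pn [k rk]; rewrite mulg1 => e.
have := wlenE rk; rewrite -e wlenV size_cat size_spow size_sword => ep.
by have := leq_pmulr n c0; lia.
Qed.

End Pairs.

(** * Playing ping-pong with a right-angled Artin group *)

Section PingPong.
Variables (K : sgraph) (G : groupType) (f : UMagmaMorphism.type (raag K) G).
Variable X : letter K -> G -> Prop.
Local Notation inv := (@inv_letter K).

Hypothesis push : forall l h, ~ X (inv l) h -> X l (f (ev [:: l]) * h).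
Hypothesis disj : forall l l' h, l != l' -> ~~ adj l.1 l'.1 -> X l h -> X l' h -> False.
Hypothesis stable : forall l l' h, adj l.1 l'.1 -> X l h -> X l (f (ev [:: l']) * h).
Hypothesis base : forall l, ~ X l 1.

(** The sets [X l] behave on [f (ev u)] as the possible initial letters [l] of
[u]. From left to right: remove [l] from [u]; what remains does not start with
the inverse of [l], so [push] applies. From right to left: compare [l] with the
first letter [a] of [u]. If [a] depends on [l], the first implication puts
[f (ev u)] in [X a], disjoint from [X l]; otherwise [a] can be removed, because
[X l] is stable under it. *)
Lemma ping_pong_starts u : reduced u -> forall l, starts u l <-> X l (f (ev u)).
Proof.
have [n] := ubnP (size u); elim: n u => [//|n IH] u un ru.
have sX l : starts u l -> X l (f (ev u)).
  move=> su; have := ru; rewrite (reduced_rem su) => /= /andP[/negP sr rr].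
  rewrite (ev_rem su) ev_cons gmulfM; apply: push => /IH h; apply: sr; apply: h => //.
  by move: un; rewrite (teq_size (teq_rem su)).
move=> l; split; first exact: sX.
case: u {IH} un ru sX (IH) => [|a u] un ru sX IH; first by rewrite gmulf1 => /base.
move=> Xl /=; have [//|al] := eqVneq a l; rewrite /=.
case: (boolP (adj a.1 l.1)) => /= aa; last first.
  by case: (disj al aa _ Xl); apply: sX; rewrite /= eqxx.
apply/(IH u) => //; first by move: ru => /andP[].
rewrite -(mulKg (ev [:: a]) (ev u)) -ev_cons -ev_invl gmulfM.
by apply: stable; rewrite //= adj_sym.
Qed.

Lemma ping_pong : injective f.
Proof.
apply: gmulf_inj => g; have [[|a u] ru <-] := ev_reduced g; first by [].
move=> fu; case: (@base a); rewrite -fu; apply/(ping_pong_starts ru).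
by rewrite /= eqxx.
Qed.

End PingPong.

(** * Homomorphisms from a right-angled Artin group *)

Section Lift.
Variables (K : sgraph) (G : groupType) (f : vertex K -> G).

Definition eval_word (w : word K) : G := \prod_(l <- w) signed l.2 (f l.1).

Lemma eval_word_cat u v : eval_word (u ++ v) = eval_word u * eval_word v.
Proof. exact: big_cat. Qed.

Lemma eval_word1 l : eval_word [:: l] = signed l.2 (f l.1).
Proof. exact: big_seq1. Qed.

(** The commutation hypothesis is an argument so that the morphism structure
can be attached to [lift_raag fC]. *)
Definition lift_raag (fC : forall x y, adj x y -> commute (f x) (f y))
    (g : raag K) : G :=
  eval_word (repr g).

Hypothesis fC : forall x y, adj x y -> commute (f x) (f y).

Lemma eval_word_weqv u v : weqv u v -> eval_word u = eval_word v.
Proof.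
elim=> {u v} // [u v w _ -> _ -> //|u u' v v' _ eu _ ev|[x s]|x y xy].
- by rewrite !eval_word_cat eu ev.
- rewrite (eval_word_cat [:: _] [:: _]) !eval_word1 /eval_word big_nil.
  by case: s => /=; rewrite ?mulgV ?mulVg.
- have -> : comm_word x y =
    [:: (x, true)] ++ [:: (y, true)] ++ [:: (x, false)] ++ [:: (y, false)] by [].
  by rewrite !eval_word_cat !eval_word1 /eval_word big_nil /= (fC xy) mulKg mulVg.
Qed.

Lemma lift_raag_ev w : lift_raag fC (ev w) = eval_word w.
Proof. by apply/eval_word_weqv/ev_eq; rewrite ev_repr. Qed.

Lemma lift_raagF : {morph lift_raag fC : g h / g / h}.
Proof.
move=> g h; have [u <-] := ev_surj g; have [v <-] := ev_surj h.
have M u' v' : lift_raag fC (ev u' * ev v') = lift_raag fC (ev u') * lift_raag fC (ev v').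
  by rewrite -evM !lift_raag_ev eval_word_cat.
have V : lift_raag fC (ev v)^-1 = (lift_raag fC (ev v))^-1.
  apply/esym/mulg1_eq; rewrite -evV -M -evM lift_raag_ev.
  by rewrite -(eval_word_weqv (weqv_sym (weqv_wV v))) /eval_word big_nil.
by rewrite -evV M evV V.
Qed.

HB.instance Definition _ := isGroupMorphism.Build (raag K) G (lift_raag fC) lift_raagF.

End Lift.

(** * Powers of pure elements *)

Lemma uniform_bound (I : finType) (P : I -> nat -> Prop) :
  (forall i, exists m, forall n, m <= n -> P i n) ->
  exists m, forall n, m <= n -> forall i, P i n.
Proof.
move=> /choice[m hm]; exists (\max_i m i) => n mn i; apply: hm.
exact: leq_trans (leq_bigmax i) mn.
Qed.

Theorem theorem44 (Gamma : sgraph) (X : {fset raag Gamma})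
  (Xirr : irredundant X)
  (Xnontrivial : forall g, g \in X -> g != 1)
  (Xpure : forall g, g \in X -> pure g) :
  exists N0 : nat, forall N : nat, (N0 <= N)%N ->
    isomorphic_to (raag (comm_graph X)) (generated (powers X N)).
Proof.
have puret (v : X) : pure (val v) by apply: Xpure; apply: valP.
have ncp (v w : X) : v != w -> ~ common_power (val v) (val w).
  by move=> vw; apply: Xirr; rewrite ?(inj_eq val_inj) //; apply: valP.
have /choice[pc hpc] (v : X) : exists pc : raag Gamma * word Gamma,
    pure_word pc.2 /\ val v ^ pc.1 = ev pc.2.
  have [q [d [gd _ e]]] := pure_form (puret v).
  by exists (ev q, d); split=> //; apply: conj_ev.
pose p v := (pc v).1; pose c v := (pc v).2.
have gc v : pure_word (c v) by have [] := hpc v.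
have ec v : val v ^ p v = ev (c v) by have [] := hpc v.
pose S n (l : letter (comm_graph X)) h :=
  cone (spow n (sword l.2 (c l.1))) ((p l.1)^-1 * h).
have [m hm] : exists m, forall n, m <= n -> forall vw : X * X,
    forall s t h, (vw.1, s) != (vw.2, t) -> ~~ comm_adj vw.1 vw.2 ->
    S n (vw.1, s) h -> S n (vw.2, t) h -> False.
  apply: uniform_bound => -[v w] /=.
  case: (eqVneq v w) => [<-|vw].
    exists ((wlen (p v) + wlen (p v)).*2.+1) => n mn s t h st _.
    have -> : t = ~~ s by case: s t st => -[] //; rewrite eqxx.
    rewrite /S /= sword_negb.
    by apply: (opposite_cones (pure_word_sword s (gc v)) (pure_word_sword s (gc v))
      (signed_conj s (ec v)) (signed_conj s (ec v))) => //; lia.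
  case: (pselect (commute (val v) (val w))) => [com|nc].
    by exists 0%N => n _ s t h _; rewrite /comm_adj vw /= => /eqP.
  have [m hm] := far_cones (gc v) (gc w) (puret w) (ec v) (ec w) (ncp _ _ vw) nc.
  by exists m => n mn s t h _ _; apply: hm.
have [b hb] : exists b, forall n, b <= n -> forall v, wlen (p v) < n.
  by apply: uniform_bound => v; exists (wlen (p v)).+1.
pose M := (m + b)%N; exists (2 * M + #|vertex Gamma|)%N => N MN.
pose a (v : vertex (comm_graph X)) := val v ^+ N.
have aC x y : adj x y -> commute (a x) (a y).
  by move=> /andP[_ /eqP xy]; apply: commuteX2.
pose f : UMagmaMorphism.type (raag (comm_graph X)) (raag Gamma) := lift_raag aC.
have fl l : f (ev [:: l]) = signed l.2 (val l.1) ^+ N.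
  by rewrite -signedX; apply: etrans (lift_raag_ev aC _) (eval_word1 _ _).
exists f; split.
  apply: (@ping_pong _ _ _ (S M)).
  - move=> l h nS; rewrite fl /S -conj_mulX (signed_conj _ (ec _)).
    apply: dichotomy MN _; first exact: pure_word_sword.
    by move=> k; apply: nS; rewrite /S /= sword_negb.
  - move=> l l' h; rewrite (surjective_pairing l) (surjective_pairing l') /= => ll D.
    by apply: (hm M (leq_addr _ _) (l.1, l'.1)).
  - move=> l l' h /andP[ll /eqP com]; rewrite fl; apply: commuting_cone => //.
    exact: ncp.
  - move=> l; apply: shallow_cone => //; apply: hb; exact: leq_addl.
apply/classical_sets.seteqP; split=> [_ [g _ <-] H [[H1 HF] HX]|].
  have HV x : H x -> H x^-1 by rewrite -div1g; apply: HF.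
  have [w <-] := ev_surj g; rewrite [f _](lift_raag_ev aC).
  elim: w => [|l w IH]; first by rewrite /eval_word big_nil.
  rewrite -cat1s eval_word_cat eval_word1 -(invgK (eval_word a w)); apply: HF; last exact: HV.
  have Ha : H (a l.1) by apply: HX; exists (val l.1) => //; apply: valP.
  by case: l.2 => /=; [apply: HV|].
apply: classical_sets.smallest_sub.
  split; first by exists 1 => //; apply: gmulf1.
  by move=> _ _ [g _ <-] [h _ <-]; exists (g / h) => //; apply: gmulfF.
move=> _ [g gX <-]; exists (@ev (comm_graph X) [:: ([` gX]%fset, false)]) => //.
by rewrite fl.
Qed.
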